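(* Let $[a:b:c]\in\mathbb{P}^2$ be such that $E={}_3E_{a,b,c}=\mathbf{V}\big(abc(X^3+Y^3+Z^3)-(a^3+b^3+c^3)XYZ\big)\subset\mathbb{P}^2$ is a smooth curve of genus 1, let $S={}_3S_{a,b,c}$ be the corresponding quadratic Sklyanin algebra, and let ${}_3c_{a,b,c}\in S_3$ be the normal element of degree 3 generating the ideal $\bigcap_{p\in E}\mathrm{Ann}_S(M_p)$. Then ${}_3c_{a,b,c}$ is a central element of ${}_3S_{a,b,c}$.
   Context: All algebras are over $\mathbb{C}$. The quadratic Sklyanin algebra ${}_3S_{a,b,c}$ is the quotient of $\mathbb{C}\langle x,y,z\rangle$ (generators in degree 1) by the relations $ayz+bzy+cx^2$, $azx+bxz+cy^2$, $axy+byx+cz^2$, under the condition that ${}_3E_{a,b,c}$ is a smooth curve of genus 1. The curve ${}_3E_{a,b,c}$ is an elliptic curve with origin $O=[1:-1:0]$; put $\tau=[a:b:c]\in {}_3E_{a,b,c}$. A point module is a cyclic graded right module with Hilbert series $(1-t)^{-1}$. The point modules of ${}_3S_{a,b,c}$ are, up to isomorphism, exactly the modules $M_p$, $p\in {}_3E_{a,b,c}$, where $M_p=\bigoplus_{i\ge 0}\mathbb{C}m_i$ with $m_i x=x_i m_{i+1}$, $m_i y=y_i m_{i+1}$, $m_i z=z_i m_{i+1}$ and $[x_i:y_i:z_i]=p+i\tau$ (addition on the elliptic curve). $\mathrm{Ann}_S(M)=\{s\in S: ms=0 \text{ for all } m\in M\}$. By a result of Artin, Tate and Van den Bergh, the two-sided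 ideal $\bigcap_{p\in {}_3E_{a,b,c}}\mathrm{Ann}_S(M_p)$ is generated by a (nonzero) normal element of degree 3, unique up to scalar, denoted ${}_3c_{a,b,c}$. *)

(* Defs.v *)
From HB Require Import structures.
From mathcomp Require Import all_boot all_order all_algebra.
From mathcomp Require Import boolp reals complex.
From mathcomp Require Import mpoly.

Set Implicit Arguments.
Unset Strict Implicit.
Unset Printing Implicit Defensive.

Import GRing.Theory.
Local Open Scope ring_scope.
Local Open Scope quotient_scope.

Section Curve.
Variable K : fieldType.
Implicit Types (F : {mpoly K[3]}) (P Q R O : 'rV[K]_3).

(* Points of P^2 are given by nonzero row vectors of homogeneous coordinates. *)
Definition vec3 (x y z : K) : 'rV[K]_3 :=
  \row_(i < 3) [:: x; y; z]`_i.

Definition same_point P Q : Prop := exists2 k : K, k != 0 & Q = k *: P.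

Definition on_curve F P : Prop := P != 0 /\ F.@[P 0] = 0.

(* The Jacobian criterion for the plane curve V(F).  For F homogeneous of
   degree 3, it rules out F = 0, and V(F) then has genus 1 by the genus-degree
   formula. *)
Definition smooth_curve F : Prop :=
  forall P, on_curve F P -> exists i : 'I_3, (F^`M(i)).@[P 0] != 0.

Definition sklyanin_cubic (a b c : K) : {mpoly K[3]} :=
  (a * b * c) *: ('X_0 ^+ 3 + 'X_1 ^+ 3 + 'X_2%:R ^+ 3)
  - (a ^+ 3 + b ^+ 3 + c ^+ 3) *: ('X_0 * 'X_1 * 'X_2%:R).

(* Some line of P^2 meets the cubic V(F) exactly in P + Q + R, counted with
   multiplicity.  The line is parametrised by w |-> w *m L; the form
   w |-> \det (col_mx w p) on K^2 vanishes exactly on the multiples of p. *)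
Definition line_section F P Q R : Prop :=
  exists (L : 'M[K]_(2, 3)) (p q r : 'rV[K]_2) (k : K),
    [/\ row_free L, k != 0, [/\ p != 0, q != 0 & r != 0],
        [/\ P = p *m L, Q = q *m L & R = r *m L] &
        forall w : 'rV[K]_2,
          F.@[(w *m L) 0] =
          k * (\det (col_mx w p : 'M_2) * \det (col_mx w q : 'M_2)
               * \det (col_mx w r : 'M_2))].

(* Chord-tangent addition P + Q = S on V(F), with origin O. *)
Definition ec_add F O P Q S : Prop :=
  exists R, line_section F P Q R /\ line_section F O R S.

(* The point Q is P + i T, that is P + T + ... + T with i summands T. *)
Fixpoint ec_translate F O T P (i : nat) Q : Prop :=
  if i is i'.+1 then exists2 R, ec_translate F O T P i' R & ec_add F O R T Q
  else same_point P Q.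

End Curve.

(* Membership in the two-sided ideal of A generated by G. *)
Definition ideal_gen (A : nzRingType) (G : A -> Prop) (s : A) : Prop :=
  exists (n : nat) (u g v : 'I_n -> A),
    (forall i, G (g i)) /\ s = \sum_i u i * g i * v i.

Definition normal_elt (A : nzRingType) (g : A) : Prop :=
  (forall s, exists t, g * s = t * g) /\ (forall s, exists t, s * g = g * t).

Definition central_elt (A : nzRingType) (g : A) : Prop :=
  forall s, g * s = s * g.

(* Right A-modules are left modules over the converse ring A^c. *)
Definition ract (A : nzRingType) (M : lmodType A^c) (m : M) (s : A) : M :=
  (s : A^c) *: m.

Definition Ann (A : nzRingType) (M : lmodType A^c) (s : A) : Prop :=
  forall m : M, ract m s = 0.

(* K acts on M through the scalars k%:A of A. *)
Definition is_linear_basis (K : fieldType) (A : algType K) (M : lmodType A^c)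
    (m : nat -> M) : Prop :=
  (forall v : M, exists (n : nat) (k : 'I_n -> K),
     v = \sum_(i < n) ract (m i) (k i)%:A) /\
  (forall (n : nat) (k : 'I_n -> K),
     \sum_(i < n) ract (m i) (k i)%:A = 0 -> forall i, k i = 0).

Section IdealQuotient.
Variables (K : fieldType) (A : algType K) (G : A -> Prop).

Definition ideal_pred : {pred A} := fun f => `[< ideal_gen G f >].

Lemma ideal_predP f : reflect (ideal_gen G f) (f \in ideal_pred).
Proof. exact: asboolP. Qed.

Lemma ideal_pred_zmod_closed : zmod_closed ideal_pred.
Proof.
split; first by apply/ideal_predP; exists 0%N, (fun _ => 0), (fun _ => 0),
  (fun _ => 0); split=> [[]|]; rewrite ?big_ord0.
move=> f1 f2 /ideal_predP[n1 [u1 [g1 [v1 [G1 ->]]]]].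
move=> /ideal_predP[n2 [u2 [g2 [v2 [G2 ->]]]]].
apply/ideal_predP; exists (n1 + n2)%N.
pose glue (h1 : 'I_n1 -> A) (h2 : 'I_n2 -> A) i :=
  match split i with inl j => h1 j | inr j => h2 j end.
exists (glue u1 (fun j => - u2 j)), (glue g1 g2), (glue v1 v2).
split=> [i|]; first by rewrite /glue; case: split.
have glueL h1 h2 j : glue h1 h2 (lshift n2 j) = h1 j.
  by rewrite /glue -[lshift _ _]/(unsplit (inl j)) unsplitK.
have glueR h1 h2 j : glue h1 h2 (rshift n1 j) = h2 j.
  by rewrite /glue -[rshift _ _]/(unsplit (inr j)) unsplitK.
rewrite big_split_ord -[- \sum_i _]sumrN.
apply: (congr2 +%R); apply: eq_bigr => i _; first by rewrite 3!glueL.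
by rewrite 3!glueR !mulNr.
Qed.

Lemma ideal_predMl u f : f \in ideal_pred -> u * f \in ideal_pred.
Proof.
move=> /ideal_predP[n [w [g [v [Gg ->]]]]]; apply/ideal_predP.
exists n, (fun i => u * w i), g, v; split=> //.
by rewrite mulr_sumr; apply: eq_bigr => i _; rewrite !mulrA.
Qed.

Lemma ideal_predMr u f : f \in ideal_pred -> f * u \in ideal_pred.
Proof.
move=> /ideal_predP[n [w [g [v [Gg ->]]]]]; apply/ideal_predP.
exists n, w, g, (fun i => v i * u); split=> //.
by rewrite mulr_suml; apply: eq_bigr => i _; rewrite !mulrA.
Qed.

HB.instance Definition _ :=
  GRing.isZmodClosed.Build A ideal_pred ideal_pred_zmod_closed.

Hypothesis G_proper : ~ ideal_gen G 1.

(* The ring structures that carry an algebra structure are nontrivial, hence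
   the dependency on G_proper. *)
Definition alg_quot of ~ ideal_gen G 1 := Quotient.quot ideal_pred.
Local Notation Q := (alg_quot G_proper).

HB.instance Definition _ := Choice.on Q.
HB.instance Definition _ := GRing.Zmodule.on Q.

Definition qpi (f : A) : Q := \pi_(Quotient.quot ideal_pred) f.

Lemma qpi_eq f g : (qpi f == qpi g) = (f - g \in ideal_pred).
Proof. by rewrite Quotient.idealrBE. Qed.

Lemma qpi_surj (s : Q) : exists f, qpi f = s.
Proof. by exists (repr (s : Quotient.quot ideal_pred)); exact: reprK. Qed.

Definition qrep (s : Q) : A := repr (s : Quotient.quot ideal_pred).

Let qpi_qrep (s : Q) : qpi (qrep s) = s.
Proof. exact: reprK. Qed.

Let qrep_qpi f : f - qrep (qpi f) \in ideal_pred.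
Proof. by rewrite -qpi_eq qpi_qrep. Qed.

Fact qpiB : {morph qpi : f g / f - g}.
Proof. exact: (raddfB \pi_(Quotient.quot ideal_pred)). Qed.

Let qpiD : {morph qpi : f g / f + g}.
Proof. exact: (raddfD \pi_(Quotient.quot ideal_pred)). Qed.

Definition qmul (s t : Q) := qpi (qrep s * qrep t).
Definition qscale (k : K) (s : Q) := qpi (k *: qrep s).

Let qpiM f g : qpi (f * g) = qmul (qpi f) (qpi g).
Proof.
apply/eqP; rewrite qpi_eq -[f * g](subrK (qrep (qpi f) * g)) -addrA.
rewrite -mulrBl -mulrBr.
by apply: rpredD; [apply: ideal_predMr | apply: ideal_predMl].
Qed.

Fact qpiZ k f : qpi (k *: f) = qscale k (qpi f).
Proof.
by apply/eqP; rewrite qpi_eq -scalerBr -mulr_algl ideal_predMl.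
Qed.

Let piP (P : Q -> Prop) : (forall f, P (qpi f)) -> forall s, P s.
Proof. by move=> Ppi s; rewrite -[s]qpi_qrep. Qed.

Fact qmulA : associative qmul.
Proof. by elim/piP=> f; elim/piP=> g; elim/piP=> h; rewrite -!qpiM mulrA. Qed.

Fact qmul1 : left_id (qpi 1) qmul.
Proof. by elim/piP=> f; rewrite -qpiM mul1r. Qed.

Fact qmulr1 : right_id (qpi 1) qmul.
Proof. by elim/piP=> f; rewrite -qpiM mulr1. Qed.

Fact qmulDl : left_distributive qmul +%R.
Proof.
elim/piP=> f; elim/piP=> g; elim/piP=> h.
by rewrite -qpiD -!qpiM mulrDl qpiD.
Qed.

Fact qmulDr : right_distributive qmul +%R.
Proof.
elim/piP=> f; elim/piP=> g; elim/piP=> h.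
by rewrite -qpiD -!qpiM mulrDr qpiD.
Qed.

Fact qone_neq0 : qpi 1 != 0.
Proof.
have <- : qpi 0 = 0 by exact: (raddf0 \pi_(Quotient.quot ideal_pred)).
by rewrite qpi_eq subr0; apply/ideal_predP.
Qed.

HB.instance Definition _ := GRing.Zmodule_isNzRing.Build Q
  qmulA qmul1 qmulr1 qmulDl qmulDr qone_neq0.

Fact qscaleA k l (s : Q) : qscale k (qscale l s) = qscale (k * l) s.
Proof. by elim/piP: s => f; rewrite -!qpiZ scalerA. Qed.

Fact qscale1 : left_id 1 qscale.
Proof. by elim/piP=> f; rewrite -qpiZ scale1r. Qed.

Fact qscaleDr : right_distributive qscale +%R.
Proof.
by move=> k; elim/piP=> f; elim/piP=> g; rewrite -qpiD -!qpiZ scalerDr qpiD.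
Qed.

Fact qscaleDl (s : Q) : {morph qscale^~ s : k l / k + l}.
Proof. by elim/piP: s => f k l; rewrite -!qpiZ scalerDl qpiD. Qed.

HB.instance Definition _ := GRing.Zmodule_isLmodule.Build K Q
  qscaleA qscale1 qscaleDr qscaleDl.

Fact qscaleAl (k : K) (s t : Q) : k *: (s * t) = (k *: s) * t.
Proof.
elim/piP: s => f; elim/piP: t => g.
by rewrite -[_ * _]qpiM -[_ *: _]qpiZ scalerAl qpiM qpiZ.
Qed.

Fact qscaleAr (k : K) (s t : Q) : k *: (s * t) = s * (k *: t).
Proof.
elim/piP: s => f; elim/piP: t => g.
by rewrite -[_ * _]qpiM -[_ *: _]qpiZ scalerAr qpiM qpiZ.
Qed.

HB.instance Definition _ := GRing.Lmodule_isLalgebra.Build K Q qscaleAl.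
HB.instance Definition _ := GRing.Lalgebra_isAlgebra.Build K Q qscaleAr.

Fact qpi_monoid_morphism : monoid_morphism qpi.
Proof. by split=> // f g; rewrite qpiM. Qed.

HB.instance Definition _ := GRing.isZmodMorphism.Build A Q qpi qpiB.
HB.instance Definition _ :=
  GRing.isMonoidMorphism.Build A Q qpi qpi_monoid_morphism.
HB.instance Definition _ := GRing.isScalable.Build K A Q *:%R qpi qpiZ.

End IdealQuotient.

(* A quotient of A by the two-sided ideal generated by G: an algebra with a
   surjective algebra morphism from A whose kernel is that ideal. *)
Record quotient_alg (K : fieldType) (A : algType K) (G : A -> Prop) := {
  quot_alg : algType K;
  quot_pi : {lrmorphism A -> quot_alg};
  quot_pi_surj : forall s, exists f, quot_pi f = s;
  quot_pi_ker : forall f, quot_pi f = 0 <-> ideal_gen G f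
}.

(* Ends with Qed so that unification never unfolds the quotient ring. *)
Lemma quotient_algP (K : fieldType) (A : algType K) (G : A -> Prop) :
  ~ ideal_gen G 1 -> quotient_alg G.
Proof.
move=> G1; exists (alg_quot G1) (qpi G1) => [s|f]; first exact: qpi_surj.
rewrite -(raddf0 (qpi G1)); split=> [/eqP|Gf].
  by rewrite qpi_eq subr0 => /ideal_predP.
by apply/eqP; rewrite qpi_eq subr0; apply/ideal_predP.
Qed.

Lemma ideal_gen_proper (A B : nzRingType) (eps : {rmorphism A -> B})
    (G : A -> Prop) :
  (forall r, G r -> eps r = 0) -> ~ ideal_gen G 1.
Proof.
move=> epsG [n [u [g [v [Gg]]]]] /(congr1 eps).
rewrite rmorph1 rmorph_sum big1 => [/eqP|i _]; first by rewrite oner_eq0.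
by rewrite !rmorphM (epsG (g i)) // mulr0 mul0r.
Qed.

(* Loaded only here: monalg redefines the notation {mpoly K[n]} used above. *)
From mathcomp Require Import monalg.

Section FreeAlgebra.
Variable K : fieldType.

Definition free3 := {malg K[{fmonom 'I_3}]}.
HB.instance Definition _ := GRing.Lalgebra.on free3.

Fact free3_scalerAr (k : K) (f g : free3) : k *: (f * g) = f * (k *: g).
Proof.
have mul_malgCr (h : free3) : h * malgC k = k *: h.
  rewrite malgM_def fgmulgU malgZ_def; apply: eq_bigr => m _.
  by rewrite mulm1 mulrC.
by rewrite -[k *: g]mul_malgCr mulrA mul_malgCr.
Qed.

HB.instance Definition _ :=
  GRing.Lalgebra_isAlgebra.Build K free3 free3_scalerAr.

Definition var (j : 'I_3) : free3 := << fmu j >>.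

End FreeAlgebra.

Definition sklyanin_rels (K : fieldType) (A : algType K) (a b c : K)
    (x y z : A) : seq A :=
  [:: a *: (y * z) + b *: (z * y) + c *: x ^+ 2;
      a *: (z * x) + b *: (x * z) + c *: y ^+ 2;
      a *: (x * y) + b *: (y * x) + c *: z ^+ 2].

Lemma sklyanin_rels0 (K : fieldType) (A : algType K)
    (eps : {rmorphism A -> K}) (a b c : K) (x y z : A) :
  eps x = 0 -> eps y = 0 -> eps z = 0 ->
  (forall k f, eps (k *: f) = k * eps f) ->
  forall r, r \in sklyanin_rels a b c x y z -> eps r = 0.
Proof.
move=> x0 y0 z0 epsZ r; rewrite !inE => /or3P[] /eqP ->.
all: rewrite 2!rmorphD 3!epsZ rmorphXn 2!rmorphM.
all: by rewrite x0 y0 z0 expr0n !mulr0 !addr0.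
Qed.

Section Sklyanin.
Variables (K : fieldType) (a b c : K).

Definition sklyanin_rel (r : free3 K) : Prop :=
  r \in sklyanin_rels a b c (var K 0) (var K 1) (var K 2%:R).

Lemma sklyanin_proper : ~ ideal_gen sklyanin_rel 1.
Proof.
pose eps : free3 K -> K := mcoeff (mone : {fmonom 'I_3}).
pose epsR : {rmorphism free3 K -> K} := eps.
have epsZ k x : epsR (k *: x) = k * epsR x by exact: mcoeffZ.
have eps_var j : epsR (var K j) = 0.
  rewrite /epsR /= /eps mcoeffU; case: eqP => // /(congr1 (@fdeg _)).
  by rewrite fdegU fdeg1.
apply: (@ideal_gen_proper _ _ epsR) => r; rewrite /sklyanin_rel.
exact: (@sklyanin_rels0 _ (free3 K) epsR a b c _ _ _
  (eps_var 0) (eps_var 1) (eps_var 2%:R) epsZ).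
Qed.

Definition sklyanin_quotient : quotient_alg sklyanin_rel :=
  quotient_algP sklyanin_proper.

Definition sklyanin : algType K := quot_alg sklyanin_quotient.

Definition sklyanin_pi : {lrmorphism free3 K -> sklyanin} :=
  quot_pi sklyanin_quotient.

Definition sklyanin_gen (j : 'I_3) : sklyanin := sklyanin_pi (var K j).

(* The degree d component S_d is spanned by the words of length d in x, y, z. *)
Definition sklyanin_homog (d : nat) (s : sklyanin) : Prop :=
  exists k : d.-tuple 'I_3 -> K,
    s = \sum_(w : d.-tuple 'I_3) k w *: \prod_(j <- w) sklyanin_gen j.

(* M is (isomorphic to) the point module M_P: it has a K-basis m_0, m_1, ...
   with m_i x_j = (q_i)_j m_{i+1}, where q_i = P + i tau, tau = [a:b:c]. *)
Definition is_point_module (P : 'rV[K]_3) (M : lmodType sklyanin^c) : Prop :=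
  exists (m : nat -> M) (q : nat -> 'rV[K]_3),
    [/\ is_linear_basis m,
        forall i, ec_translate (sklyanin_cubic a b c) (vec3 1 (-1) 0)
                    (vec3 a b c) P i (q i) &
        forall (i : nat) (j : 'I_3),
          ract (m i) (sklyanin_gen j) = ract (m i.+1) (q i 0 j)%:A].

(* Membership in the intersection of the annihilators Ann(M_P), P in E. *)
Definition point_ann (s : sklyanin) : Prop :=
  forall P, on_curve (sklyanin_cubic a b c) P ->
  forall M : lmodType sklyanin^c, is_point_module P M -> Ann M s.

End Sklyanin.

(* Main.v *)
Require Import Defs.
From mathcomp Require Import all_boot all_order all_algebra.
From mathcomp Require Import reals complex.
From mathcomp Require Import mpoly.
From mathcomp Require Import monalg ring.
Import GRing.Theory.

(* The cubic element
     omega = c(c^3-b^3) y^3 + b(c^3-a^3) yxz + a(b^3-c^3) xyz + c(a^3-c^3) x^3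
   of S is central.  It kills the point modules: if p, q, r are consecutive
   points of a point module, then the relations say that p and r span the right
   and left kernels of a matrix N(q) of linear forms, so p_i r_j is proportional
   to the entries of adj N(q), and omega(p, q, r) vanishes because a linear
   combination of these entries is identically zero.  Hence omega lies in the
   ideal generated by g, and since both have degree 3, omega is a scalar
   multiple of g.  As omega is nonzero in S, g is central. *)

Set Implicit Arguments.
Unset Strict Implicit.
Unset Printing Implicit Defensive.
Local Open Scope ring_scope.

(** * Formal noncommutative polynomials *)

Section NCPoly.
Variables (K : fieldType) (A : algType K) (X : nat -> A).

(* The letters 0, 1, 2 stand for x, y, z. *)
Definition ncpoly := seq (K * seq nat).

Definition nceval (l : ncpoly) : A :=
  \sum_(t <- l) t.1 *: \prod_(i <- t.2) X i.

(** Recursive and based on [eqseq], so that simplification on concrete words leaves plain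
    polynomials in the parameters. *)
Definition nccoef (l : ncpoly) (w : seq nat) : K :=
  foldr (fun t s => if eqseq t.2 w then t.1 + s else s) 0 l.

Definition ncsandwich (k : K) (u : seq nat) (l : ncpoly) (v : seq nat) : ncpoly :=
  [seq (k * t.1, u ++ t.2 ++ v) | t <- l].

Lemma nceval_cat l1 l2 : nceval (l1 ++ l2) = nceval l1 + nceval l2.
Proof. exact: big_cat. Qed.

Lemma nceval_sandwich k u l v :
  nceval (ncsandwich k u l v) =
  k *: (\prod_(i <- u) X i * nceval l * \prod_(i <- v) X i).
Proof.
rewrite /nceval big_map mulr_sumr mulr_suml scaler_sumr.
apply: eq_bigr => t _; rewrite !big_cat /= -scalerA; congr (_ *: _).
by rewrite -scalerAr -scalerAl mulrA.
Qed.

(** Collecting equal words turns an identity in [A] into one scalar identity per listed word, which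
    [ring] can prove. The hypothesis is a [foldr] so that it unfolds to a conjunction of these. *)
Lemma nceval_eq0 l :
  foldr (fun t P => nccoef l t.2 = 0 /\ P) True l -> nceval l = 0.
Proof.
have nccoefE w : nccoef l w = \sum_(t <- l | t.2 == w) t.1.
  elim: l => [|t l IHl]; first by rewrite big_nil.
  by rewrite big_cons /= IHl -[eqseq _ _]/(t.2 == w).
have all0 l' : foldr (fun t P => nccoef l t.2 = 0 /\ P) True l' ->
    {in [seq t.2 | t <- l'], forall w, nccoef l w = 0}.
  elim: l' => [|t l' IH] //= [t0 /IH l'0] w.
  by rewrite inE => /predU1P[->|/l'0].
move=> /all0 l0.
(* Each term is spread over the distinct words, where only its own word counts; exchanging the sums
   then puts [nccoef l w] in front of each word. *)
rewrite /nceval (eq_big_seq (fun t : K * seq nat =>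
  \sum_(w <- undup [seq t.2 | t <- l] | w == t.2) t.1 *: \prod_(i <- w) X i)).
  rewrite (exchange_big_dep xpredT) //= big1_seq // => w /andP[_].
  rewrite mem_undup => /l0; rewrite nccoefE -scaler_suml => lw.
  rewrite -[RHS](scale0r (\prod_(i <- w) X i)) -[in RHS]lw; congr (_ *: _).
  by apply: eq_bigl => t; rewrite eq_sym.
move=> t lt; rewrite [RHS]big_mkcond /= (bigD1_seq t.2) ?undup_uniq //=.
  by rewrite eqxx [X in _ + X]big1 ?addr0 // => w /negPf ->.
by rewrite mem_undup map_f.
Qed.

End NCPoly.

(** * Linear maps out of the free algebra *)

Section LinearExtension.
Variables (K : fieldType) (A : algType K).

(** Letters become natural numbers, so that functions on words such as [phi] can match on
    numerals. *)
Definition letters (m : {fmonom 'I_3}) : seq nat := [seq val i | i <- (m : seq _)].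

(* The type ascription keeps unification inside the structures of free3. *)
Definition mon (m : {fmonom 'I_3}) : free3 K := << m >>.

Lemma monM m m' : mon m * mon m' = mon (mmul m m').
Proof. by rewrite /mon [LHS]malgM_def fgmulUU mulr1. Qed.

(** The words are a basis of the free algebra, so [h] is arbitrary; it need not be
    multiplicative. *)
Definition lin (h : seq nat -> A) (f : free3 K) : A :=
  mmap (in_alg A) (fun m => h (letters m)) f.

Lemma linD h f g : lin h (f + g) = lin h f + lin h g.
Proof. exact: mmapD. Qed.

Lemma linZ h k f : lin h (k *: f) = k *: lin h f.
Proof.
rewrite /lin (mmapEw (msuppZ_le k f)) mmapE scaler_sumr.
by apply: eq_bigr => m _; rewrite mcoeffZ /= !mulr_algl scalerA.
Qed.

Lemma lin0 h : lin h 0 = 0.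
Proof. exact: mmap0. Qed.

Lemma lin_sum h I (r : seq I) P (F : I -> free3 K) :
  lin h (\sum_(i <- r | P i) F i) = \sum_(i <- r | P i) lin h (F i).
Proof. by apply: (big_morph (lin h) (linD h) (lin0 h)). Qed.

Lemma linU h (m : {fmonom 'I_3}) : lin h (mon m) = h (letters m).
Proof. by rewrite /lin mmapU /= scale1r mul1r. Qed.

Lemma free3_ind (P : free3 K -> Prop) :
  P 0 -> (forall f g, P f -> P g -> P (f + g)) ->
  (forall k f, P f -> P (k *: f)) -> (forall m, P (mon m)) -> forall f, P f.
Proof.
move=> P0 PD PZ PU f; rewrite [f]monalgE.
apply: big_ind => // m _.
have -> : << mcoeff m f *g m >> = mcoeff m f *: mon m.
  apply/malgP => m'; rewrite (mcoeffZ _ (mon m)) [LHS]mcoeffU /mon mcoeffU.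
  by rewrite mulrnAr mulr1.
exact: PZ.
Qed.

Lemma lin_sandwich h (m m' : {fmonom 'I_3}) f :
  lin h (mon m * f * mon m') =
  lin (fun w => h (letters m ++ w ++ letters m')) f.
Proof.
elim/free3_ind: f => [|f g IHf IHg|k f IHf|n].
- by rewrite mulr0 mul0r !lin0.
- by rewrite mulrDr mulrDl (linD h) (linD _ f g); congr (_ + _).
- by rewrite -scalerAr -scalerAl (linZ h) (linZ _ k f); congr (_ *: _).
rewrite linU !monM linU; congr h.
by rewrite /letters /= /mmul /= /fmmul !fmE /= -catA !map_cat.
Qed.

(** [W] is a linear subspace. Linearity in [u] and [v] reduces the claim to words, which
    [lin_sandwich] absorbs into [h]. It serves with [W] zero and with [W] the line spanned by the
    normal element. *)
Lemma lin_sandwich_closed (W : A -> Prop) h f :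
  W 0 -> (forall x y, W x -> W y -> W (x + y)) ->
  (forall k x, W x -> W (k *: x)) ->
  (forall u v, W (lin (fun w => h (u ++ w ++ v)) f)) ->
  forall u v, W (lin h (u * f * v)).
Proof.
move=> W0 WD WZ Wf u v; elim/free3_ind: u => [|u u' IH IH'|k u IH|m].
- by rewrite !mul0r lin0.
- by rewrite !mulrDl linD; apply: WD.
- by rewrite -!scalerAl linZ; apply: WZ.
elim/free3_ind: v => [|v v' IH IH'|k v IH|m'].
- by rewrite mulr0 lin0.
- by rewrite mulrDr linD; apply: WD.
- by rewrite -!scalerAr linZ; apply: WZ.
by rewrite lin_sandwich.
Qed.

(** The criterion for [lin h] to descend to the quotient by [G], applied below to [phi] and to
    [homog_word]. *)
Lemma lin_ideal h (G : free3 K -> Prop) :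
  (forall r, G r -> forall u v, lin (fun w => h (u ++ w ++ v)) r = 0) ->
  forall f, ideal_gen G f -> lin h f = 0.
Proof.
move=> hG f [n [u [g [v [Gg ->]]]]]; rewrite lin_sum big1 // => i _.
apply: (@lin_sandwich_closed (eq^~ 0)) => [|x y -> ->|k x ->|u' v'] //.
- by rewrite addr0.
- by rewrite scaler0.
- exact: hG.
Qed.

Lemma mon_prod m : mon m = \prod_(i <- (m : seq _)) var K i.
Proof.
case: m => w; suff: FMonom w = \big[mmul/mone]_(i <- w) fmu i.
  move=> wE; rewrite [in LHS]wE /= {wE}.
  elim: w => [|i w IHw]; first by rewrite !big_nil.
  by rewrite !big_cons -monM IHw.
apply/eqP; rewrite fmP; apply/eqP => /=.
elim: w => [|i w IHw]; first by rewrite big_nil fm1.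
by rewrite big_cons /mmul /= /fmmul fmE /= -IHw fmuE.
Qed.

Lemma lin_word h (w : seq 'I_3) :
  lin h (\prod_(i <- w) var K i) = h [seq val i | i <- w].
Proof. by rewrite -[w]/(FMonom w : seq _) -mon_prod linU. Qed.

End LinearExtension.

(** * The cubic element and its commutation with the generators *)

Section Omega.
Variables (K : fieldType) (a b c : K).

Definition skl_rel (i : nat) : ncpoly K := nth [::]
  [:: [:: (a, [:: 1; 2]); (b, [:: 2; 1]); (c, [:: 0; 0])];
      [:: (a, [:: 2; 0]); (b, [:: 0; 2]); (c, [:: 1; 1])];
      [:: (a, [:: 0; 1]); (b, [:: 1; 0]); (c, [:: 2; 2])]]%N i.

Definition omega : ncpoly K :=
  [:: (c * (c ^+ 3 - b ^+ 3), [:: 1; 1; 1]%N);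
      (b * (c ^+ 3 - a ^+ 3), [:: 1; 0; 2]%N);
      (a * (b ^+ 3 - c ^+ 3), [:: 0; 1; 2]%N);
      (c * (a ^+ 3 - c ^+ 3), [:: 0; 0; 0]%N)].

Variable A : algType K.

Lemma nceval_skl_relE (X : nat -> A) i : (i < 3)%N ->
  nceval X (skl_rel i) =
  nth 0 (sklyanin_rels a b c (X 0%N) (X 1%N) (X 2%N)) i.
Proof.
case: i => [|[|[|//]]] _; rewrite /nceval /skl_rel !big_cons !big_nil /=.
all: by rewrite !mulr1 addr0 addrA expr2.
Qed.

(* The certificate, a combination of the relations in degree 4, was found by
   linear algebra over Q[a, b, c]. *)
Lemma omega_commX (X : nat -> A) :
  (forall i, nceval X (skl_rel i) = 0) ->
  nceval X omega * X 0%N = X 0%N * nceval X omega.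
Proof.
move=> X0.
have: nceval X (
      ncsandwich 1 [::] omega [:: 0%N] ++ ncsandwich (- 1) [:: 0%N] omega [::] ++
      ncsandwich (- c ^+ 3) [:: 1]%N (skl_rel 1) [:: 0]%N ++
      ncsandwich (- a * b * c) [:: 1]%N (skl_rel 2) [:: 1]%N ++
      ncsandwich (- a ^+ 2 * b) [::] (skl_rel 2) [:: 0; 2]%N ++
      ncsandwich (a * b * c) [:: 2]%N (skl_rel 1) [:: 2]%N ++
      ncsandwich (a * c ^+ 2) [:: 1; 2]%N (skl_rel 0) [::] ++
      ncsandwich (b ^+ 2 * c) [:: 1; 1]%N (skl_rel 2) [::] ++
      ncsandwich (a ^+ 2 * b) [:: 1; 0]%N (skl_rel 1) [::] ++
      ncsandwich (- a * c ^+ 2) [::] (skl_rel 0) [:: 1; 2]%N ++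
      ncsandwich (c ^+ 3 - b ^+ 3) [:: 0; 1]%N (skl_rel 1) [::] ++
      ncsandwich (- b ^+ 2 * c) [::] (skl_rel 1) [:: 2; 2]%N ++
      ncsandwich (b ^+ 3) [:: 0]%N (skl_rel 2) [:: 2]%N) = 0.
  apply: nceval_eq0 => /=.
  by repeat split; ring.
rewrite !nceval_cat !nceval_sandwich !X0 !(mulr0, mul0r, scaler0) !addr0.
rewrite !big_seq1 !big_nil mul1r mulr1 scale1r scaleN1r.
by move/eqP; rewrite subr_eq0 => /eqP.
Qed.

Let rot (X : nat -> A) i := X (nth 0 [:: 1; 2; 0] i)%N.

(** The rotation x -> y -> z -> x permutes the relations, and [omega] differs from its rotation
    [omega'] by a combination of them. Hence commutation with x alone gives commutation with y and
    z. *)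
Lemma omega_rot (X : nat -> A) :
  (forall i, nceval X (skl_rel i) = 0) -> nceval (rot X) omega = nceval X omega.
Proof.
move=> X0.
pose omega' := [seq (t.1, [seq nth 0 [:: 1; 2; 0] i | i <- t.2]%N) | t <- omega].
have -> : nceval (rot X) omega = nceval X omega'.
  rewrite /nceval big_map; apply: eq_bigr => t _; by rewrite big_map.
have: nceval X (
      ncsandwich 1 [::] omega [::] ++ ncsandwich (- 1) [::] omega' [::] ++
      ncsandwich (c ^+ 3 - a ^+ 3) [::] (skl_rel 0) [:: 0]%N ++
      ncsandwich (b ^+ 3 + a ^+ 3 - 2%:R * c ^+ 3) [:: 1]%N (skl_rel 1) [::] ++
      ncsandwich (c ^+ 3 - b ^+ 3) [::] (skl_rel 2) [:: 2]%N) = 0.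
  apply: nceval_eq0 => /=.
  by repeat split; ring.
rewrite !nceval_cat !nceval_sandwich !X0 !(mulr0, mul0r, scaler0) !addr0.
rewrite !big_nil !mul1r !mulr1 scale1r scaleN1r.
by move/eqP; rewrite subr_eq0 => /eqP.
Qed.

Lemma omega_comm (X : nat -> A) i : (i < 3)%N ->
  (forall i, nceval X (skl_rel i) = 0) ->
  nceval X omega * X i = X i * nceval X omega.
Proof.
move=> i3 X0.
have rot0 Y : (forall i, nceval Y (skl_rel i) = 0) ->
    forall i, nceval (rot Y) (skl_rel i) = 0.
  move=> Y0 [|[|[|j]]]; last by rewrite /skl_rel /= nth_nil /nceval big_nil.
  - by rewrite -(Y0 1%N) /nceval !big_cons !big_nil.
  - by rewrite -(Y0 2%N) /nceval !big_cons !big_nil.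
  - by rewrite -(Y0 0%N) /nceval !big_cons !big_nil.
case: i i3 => [|[|[|]]] // _.
- exact: omega_commX.
- by rewrite -(omega_rot X0); exact: omega_commX (rot0 _ X0).
- rewrite -(omega_rot X0) -(omega_rot (rot0 _ X0)).
  exact: omega_commX (rot0 _ (rot0 _ X0)).
Qed.

Lemma lin_nceval h (l : ncpoly K) : all (fun t => all (gtn 3) t.2) l ->
  lin h (nceval (fun i => var K (inord i)) l) = \sum_(t <- l) t.1 *: h t.2 :> A.
Proof.
elim: l => [|t l IHl] /=; first by rewrite /nceval !big_nil lin0.
case/andP=> t3 /IHl {}IHl; rewrite /nceval !big_cons linD linZ IHl; congr (_ *: _ + _).
rewrite -(big_map (@inord 2) xpredT (var K)) lin_word -map_comp map_id_in //.
by move=> i /(allP t3); exact: inordK.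
Qed.

End Omega.

(** * Linear forms that detect the cubic element *)

Section Functional.
Variables (K : fieldType) (a b c s t : K).

(* A linear form on the cubic part of the free algebra that kills u r v for all
   words u, v and relations r.  If not a^3 = b^3 = c^3, then some choice of s, t
   gives phi omega <> 0, whence omega is nonzero in the quotient. *)
Definition phi (w : seq nat) : K := match w with
  | [:: 1; 2; 0] => (- (b * c * s))%R
  | [:: 2; 0; 1] => (- (b * c * (s + t)))%R
  | [:: 2; 1; 0] => (a * c * s)%R
  | [:: 1; 0; 2] => (- (a * c * t))%R
  | [:: 1; 1; 1] => (a * b * (s + t))%R
  | [:: 2; 2; 2] => (a * b * t)%R
  | _ => 0%R
  end%N.

Lemma phi_size w : size w != 3%N -> phi w = 0.
Proof.
by move: w => [|[|[|[|?]]] [|[|[|[|?]]] [|[|[|[|?]]] [|??]]]].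
Qed.

Lemma phi_rel i u v : (i < 3)%N ->
  \sum_(r <- skl_rel a b c i) r.1 * phi (u ++ r.2 ++ v) = 0.
Proof.
(* [phi] vanishes off length 3 and the relations are quadratic, so only a single extra letter, on
   the left or on the right, matters. *)
move=> i3; have [uv|uv] := eqVneq (size u + size v)%N 1%N; last first.
  apply: big1_seq => r /andP[_ ri]; rewrite phi_size ?mulr0 //.
  suff r2 : size r.2 = 2%N by rewrite !size_cat r2 addnCA -[3%N]/(2 + 1)%N eqn_add2l.
  by case: i i3 ri => [|[|[|//]]] _; rewrite /skl_rel /= !inE => /or3P[] /eqP ->.
case: i i3 => [|[|[|//]]] _; rewrite /skl_rel /= !big_cons big_nil /=.
all: case: u v uv => [|x [|? u]] [|y [|? v]] //= _.
1, 3, 5: case: y => [|[|[|y]]] /=; ring.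
all: case: x => [|[|[|x]]] /=; ring.
Qed.

Lemma phi_omega :
  \sum_(r <- omega a b c) r.1 * phi r.2 =
  a * b * c * ((c ^+ 3 - b ^+ 3) * s + (a ^+ 3 - b ^+ 3) * t).
Proof. by rewrite !big_cons big_nil /=; ring. Qed.

End Functional.

(* Replacing row l of N by p_i e_k - p_k e_i gives a matrix that kills p. *)
Lemma ker_adj (K : fieldType) n (N : 'M[K]_n) (p : 'cV[K]_n) :
  N *m p = 0 ->
  forall i k l, p i 0 * (\adj N) k l = p k 0 * (\adj N) i l.
Proof.
move=> Np i k l; have [->|p0] := eqVneq p 0; first by rewrite !mxE !mul0r.
pose B := \matrix_(s, t) if s == l then p i 0 * (t == k)%:R - p k 0 * (t == i)%:R
                         else N s t.
have Bp : B *m p = 0.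
  apply/matrixP => s j; rewrite ord1 !mxE.
  under eq_bigr do rewrite mxE.
  case: eqP => [_|_]; last by move/matrixP/(_ s 0): Np; rewrite !mxE.
  under eq_bigr do rewrite mulrBl -!mulrA.
  rewrite sumrB -!mulr_sumr.
  have sel m : \sum_j (j == m)%:R * p j 0 = p m 0.
    rewrite (bigD1 m) //= eqxx mul1r big1 ?addr0 // => j' /negPf ->.
    by rewrite mul0r.
  by rewrite !sel mulrC subrr.
have : \det B == 0.
  rewrite -det_tr; apply/det0P; exists p^T.
    by apply: contra p0 => /eqP pT; rewrite -[p]trmxK pT trmx0.
  by rewrite -trmx_mul Bp trmx0.
have cofB t : cofactor B l t = cofactor N l t.
  rewrite /cofactor; congr (_ * \det _); apply/matrixP => s j.
  by rewrite !mxE eq_sym (negPf (neq_lift _ _)).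
rewrite (expand_det_row _ l); under eq_bigr do rewrite cofB mxE eqxx mulrBl -!mulrA.
rewrite sumrB -!mulr_sumr.
have sel m : \sum_j (j == m)%:R * cofactor N l j = (\adj N) m l.
  rewrite (bigD1 m) //= eqxx mul1r big1 ?addr0 ?mxE // => j' /negPf ->.
  by rewrite mul0r.
by rewrite !sel subr_eq0 => /eqP.
Qed.

Lemma det_mx2 (K : comNzRingType) (A : 'M[K]_2) :
  \det A = A 0 0 * A 1 1 - A 0 1 * A 1 0.
Proof.
rewrite (expand_det_row _ 0) !big_ord_recl big_ord0 /cofactor !det_mx11 !mxE /=.
rewrite expr0 expr1 mul1r addr0 mulN1r mulrN.
by congr (A _ _ * A _ _ - A _ _ * A _ _); apply: val_inj.
Qed.

(** * Vanishing of the cubic element on three consecutive points *)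

Section Points.
Variables (K : fieldType) (a b c : K).
Hypothesis abc0 : a * b * c != 0.
Hypothesis cubes : ~ (a ^+ 3 = c ^+ 3 /\ b ^+ 3 = c ^+ 3).

(** The multilinearization of [w] at successive points: by [ract_word], the scalar with which [w]
    carries m_i to m_(i + size w). *)
Fixpoint wordval (q : nat -> 'rV[K]_3) (i : nat) (w : seq nat) : K :=
  if w is j :: w' then q i 0 (inord j) * wordval q i.+1 w' else 1.

Section Adj.
Variable q : 'rV[K]_3.
Let x := q 0 (inord 0).
Let y := q 0 (inord 1).
Let z := q 0 (inord 2).

(* For consecutive points p, q, r of a point module, the relations say that
   N *m p^T = 0 and N^T *m r^T = 0, where N = skl_mx q. *)
Definition skl_mx := \matrix_(i < 3, j < 3) nth 0 (nth [::]
  [:: [:: c * x; a * z; b * y]; [:: b * z; c * y; a * x];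
      [:: a * y; b * x; c * z]] i) j.

Lemma adj_skl_mx : \adj skl_mx = \matrix_(i < 3, j < 3) nth 0 (nth [::]
  [:: [:: c ^+ 2 * y * z - a * b * x ^+ 2; b ^+ 2 * x * y - a * c * z ^+ 2;
          a ^+ 2 * x * z - b * c * y ^+ 2];
      [:: a ^+ 2 * x * y - b * c * z ^+ 2; c ^+ 2 * x * z - a * b * y ^+ 2;
          b ^+ 2 * y * z - a * c * x ^+ 2];
      [:: b ^+ 2 * x * z - a * c * y ^+ 2; a ^+ 2 * y * z - b * c * x ^+ 2;
          c ^+ 2 * x * y - a * b * z ^+ 2]] i) j.
Proof.
apply/matrixP => [[[|[|[|//]]] i3]] [[|[|[|//]]] j3].
all: rewrite !mxE /cofactor det_mx2 !mxE /=; ring.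
Qed.

(** If the adjugate vanishes, its diagonal gives ab x^3 = ab y^3 = ab z^3 = c^2 xyz. Were x^3
    nonzero, the entries (2,1) and (1,2) would give a^3 = c^3 and b^3 = c^3, against [cubes]; so x =
    y = z = 0. *)
Lemma adj_skl_mx_neq0 : q != 0 -> \adj skl_mx != 0.
Proof.
apply: contra => /eqP; rewrite adj_skl_mx => A0.
have E (i j : nat) (i3 : (i < 3)%N) (j3 : (j < 3)%N) :=
  congr1 (fun A : 'M_3 => A (Ordinal i3) (Ordinal j3)) A0.
move: (E 0 0 isT isT) (E 1 1 isT isT) (E 2 2 isT isT) (E 2 1 isT isT) (E 1 2 isT isT)%N.
rewrite !mxE /= => /subr0_eq/esym Exx /subr0_eq/esym Eyy /subr0_eq/esym Ezz.
move=> /subr0_eq Ezy /subr0_eq Eyz.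
have ab0 : a * b != 0 by apply: contra abc0 => /eqP ->; rewrite mul0r.
have x3 : a * b * x ^+ 3 = c ^+ 2 * (x * y * z).
  by rewrite exprSr mulrA Exx; ring.
have y3 : a * b * y ^+ 3 = c ^+ 2 * (x * y * z).
  by rewrite exprSr mulrA Eyy; ring.
have z3 : a * b * z ^+ 3 = c ^+ 2 * (x * y * z).
  by rewrite exprSr mulrA Ezz; ring.
have xy : x ^+ 3 = y ^+ 3 by apply: (mulfI ab0); rewrite x3.
have xz : x ^+ 3 = z ^+ 3 by apply: (mulfI ab0); rewrite x3.
have x0 : x ^+ 3 = 0.
  apply/eqP; apply: contraT => xn; case: cubes.
  have m0 : x * y * z != 0.
    by apply: contra (mulf_neq0 ab0 xn) => /eqP m0; rewrite x3 m0 mulr0.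
  have aE : a ^+ 3 * (x * y * z) = c * (a * b * x ^+ 3).
    by transitivity (a * x * (a ^+ 2 * y * z)); [ring|rewrite Ezy; ring].
  have bE : b ^+ 3 * (x * y * z) = c * (a * b * x ^+ 3).
    by transitivity (b * x * (b ^+ 2 * y * z)); [ring|rewrite Eyz; ring].
  by split; apply: (mulIf m0); rewrite (aE, bE) x3; ring.
have cube0 (k : K) : k ^+ 3 = 0 -> k = 0 by move/eqP; rewrite expf_eq0 => /eqP.
apply/eqP/rowP => j; rewrite mxE.
have [-> | [-> | ->]] : j = inord 0 \/ j = inord 1 \/ j = inord 2.
- case: j => [[|[|[|//]]] j3]; [left|right; left|right; right];
    by apply: val_inj; rewrite /= inordK.
- exact: cube0.
- by apply: cube0; rewrite -/y -xy.
- by apply: cube0; rewrite -/z -xz.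
Qed.

End Adj.

Lemma omega_wordval (q : nat -> 'rV[K]_3) i : q i.+1 != 0 ->
  (forall n j, (j < 3)%N -> \sum_(t <- skl_rel a b c j) t.1 * wordval q n t.2 = 0) ->
  \sum_(t <- omega a b c) t.1 * wordval q i t.2 = 0.
Proof.
move=> q0 qrel; set N := skl_mx (q i.+1).
have o0 : inord 0 = ord0 :> 'I_3 by apply: val_inj; rewrite /= inordK.
have o1 : inord 1 = lift ord0 ord0 :> 'I_3 by apply: val_inj; rewrite /= inordK.
have o2 : inord 2 = lift ord0 (lift ord0 ord0) :> 'I_3.
  by apply: val_inj; rewrite /= inordK.
have Np : N *m (q i)^T = 0.
  apply/matrixP => j k; rewrite ord1 !mxE !big_ord_recl big_ord0 !mxE /=.
  rewrite -o2 -o1 -o0; have := qrel i _ (ltn_ord j).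
  case: j => [[|[|[|//]]] j3];
    rewrite /skl_rel !big_cons big_nil /= => r0; rewrite -[RHS]r0; ring.
have Nr : N^T *m (q i.+2)^T = 0.
  apply/matrixP => j k; rewrite ord1 !mxE !big_ord_recl big_ord0 !mxE /=.
  rewrite -o2 -o1 -o0; have := qrel i.+1 _ (ltn_ord j).
  case: j => [[|[|[|//]]] j3];
    rewrite /skl_rel !big_cons big_nil /= => r0; rewrite -[RHS]r0; ring.
(* By [ker_adj] for [N] and for its transpose, the columns of the adjugate are proportional to [q i]
   and its rows to [q i.+2]. *)
have rank1 j j' k k' : (\adj N) k k' * (q i 0 j * q i.+2 0 j') =
    q i 0 k * q i.+2 0 k' * (\adj N) j j'.
  have := ker_adj Np j k k'; rewrite ![_^T _ _]mxE => pE.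
  have := ker_adj Nr j' k' j; rewrite -trmx_adj ![_^T _ _]mxE => rE.
  transitivity (q i 0 j * (\adj N) k k' * q i.+2 0 j'); first by ring.
  rewrite pE; transitivity (q i 0 k * (q i.+2 0 j' * (\adj N) j k')); first by ring.
  by rewrite rE mulrA.
have [k [k' Akk']] : exists k k', (\adj N) k k' != 0.
  have /matrix0Pn[k [k' ?]] := adj_skl_mx_neq0 q0; by exists k, k'.
apply: (mulfI Akk'); rewrite mulr0 !big_cons big_nil /=.
set x := q i.+1 0 (inord 0); set y := q i.+1 0 (inord 1).
(* Multiplied by the nonzero entry (k, k'), each product of outer coordinates becomes the adjugate
   entry at the first and last letters of its word. The resulting combination of entries is
   identically zero. *)
transitivity (q i 0 k * q i.+2 0 k' * (
    c * (c ^+ 3 - b ^+ 3) * y * (\adj N) (inord 1) (inord 1) +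
    b * (c ^+ 3 - a ^+ 3) * x * (\adj N) (inord 1) (inord 2) +
    a * (b ^+ 3 - c ^+ 3) * y * (\adj N) (inord 0) (inord 2) +
    c * (a ^+ 3 - c ^+ 3) * x * (\adj N) (inord 0) (inord 0))).
  pose T j j' := \adj N k k' * (q i 0 (inord j) * q i.+2 0 (inord j')).
  transitivity (c * (c ^+ 3 - b ^+ 3) * y * T 1%N 1%N +
    b * (c ^+ 3 - a ^+ 3) * x * T 1%N 2%N + a * (b ^+ 3 - c ^+ 3) * y * T 0%N 2%N +
    c * (a ^+ 3 - c ^+ 3) * x * T 0%N 0%N); first by rewrite /T; ring.
  by rewrite /T !rank1; ring.
rewrite adj_skl_mx !mxE !inordK //= -/x -/y; ring.
Qed.

End Points.

(** * What smoothness says about the parameters *)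

Section Smooth.
Variables (K : fieldType) (a b c : K).
Let F := sklyanin_cubic a b c.

Lemma meval_mderivX n (v : 'I_n -> K) (i j : 'I_n) :
  (mderiv i (mpolyX K (mnm1 j))).@[v] = (j == i)%:R.
Proof.
rewrite mderivX mevalZ mnm1E; case: eqP => [->|_]; last by rewrite mul0r.
by rewrite -{1}[U_(i)%MM]addm0 addmC addmK mpolyX0 meval1 mulr1.
Qed.

Lemma meval_cubic (v : 'I_3 -> K) :
  F.@[v] = a * b * c * (v 0 ^+ 3 + v 1 ^+ 3 + v 2%:R ^+ 3)
           - (a ^+ 3 + b ^+ 3 + c ^+ 3) * (v 0 * v 1 * v 2%:R).
Proof. by rewrite mevalB !mevalZ !mevalD !rmorphXn !mevalM /= !mevalXU. Qed.

Lemma meval_deriv_cubic (v : 'I_3 -> K) (i : 'I_3) :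
  (mderiv i F).@[v] =
    (0 == i)%:R * (3%:R * (a * b * c) * v 0 ^+ 2
                   - (a ^+ 3 + b ^+ 3 + c ^+ 3) * (v 1 * v 2%:R))
    + (1 == i)%:R * (3%:R * (a * b * c) * v 1 ^+ 2
                   - (a ^+ 3 + b ^+ 3 + c ^+ 3) * (v 0 * v 2%:R))
    + (2%:R == i)%:R * (3%:R * (a * b * c) * v 2%:R ^+ 2
                   - (a ^+ 3 + b ^+ 3 + c ^+ 3) * (v 0 * v 1)).
Proof.
rewrite /F /sklyanin_cubic !exprS !expr0 !mulr1.
rewrite mderivB !mderivZ !mderivD !mderivM mevalB !mevalZ !mevalD !mevalM.
rewrite !mevalD !mevalM !mevalXU !meval_mderivX; ring.
Qed.

(* Applied to [1 : 0 : 0] if abc = 0 and to [c^3 : c^3 : abc] if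
   a^3 = b^3 = c^3. *)
Lemma singular_point (x y z : K) :
  vec3 x y z != 0 ->
  a * b * c * (x ^+ 3 + y ^+ 3 + z ^+ 3) = (a ^+ 3 + b ^+ 3 + c ^+ 3) * (x * y * z) ->
  3%:R * (a * b * c) * x ^+ 2 = (a ^+ 3 + b ^+ 3 + c ^+ 3) * (y * z) ->
  3%:R * (a * b * c) * y ^+ 2 = (a ^+ 3 + b ^+ 3 + c ^+ 3) * (x * z) ->
  3%:R * (a * b * c) * z ^+ 2 = (a ^+ 3 + b ^+ 3 + c ^+ 3) * (x * y) ->
  ~ smooth_curve F.
Proof.
move=> P0 F0 Fx Fy Fz /(_ (vec3 x y z))[|i].
  by split=> //; rewrite meval_cubic !mxE /= F0 subrr.
by rewrite meval_deriv_cubic !mxE /= Fx Fy Fz !subrr !mulr0 !addr0 eqxx.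
Qed.

Lemma vec3_neq0 (x y z : K) : x != 0 -> vec3 x y z != 0.
Proof. by apply: contra => /eqP/rowP/(_ 0); rewrite !mxE /= => ->. Qed.

Lemma smooth_abc_neq0 : smooth_curve F -> a * b * c != 0.
Proof.
move=> sF; apply/negP => /eqP abc0; move: sF.
apply: (@singular_point 1 0 0); rewrite ?vec3_neq0 ?oner_eq0 // abc0; ring.
Qed.

Lemma smooth_cubes : smooth_curve F -> ~ (a ^+ 3 = c ^+ 3 /\ b ^+ 3 = c ^+ 3).
Proof.
move=> sF [ac bc]; have abc0 := smooth_abc_neq0 sF; move: sF.
(* All three coordinates have cube c^9, since (abc)^3 = c^9 here. *)
apply: (@singular_point (c ^+ 3) (c ^+ 3) (a * b * c)).
- by rewrite vec3_neq0 // expf_eq0 /=; apply: contra abc0 => /eqP ->; rewrite mulr0.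
- by rewrite !exprMn_comm ?ac ?bc; [ring|exact: mulrC..].
- by rewrite ac bc; ring.
- by rewrite ac bc; ring.
- transitivity (3%:R * (a ^+ 3 * b ^+ 3 * c ^+ 3)); first by ring.
  by rewrite ac bc; ring.
Qed.

End Smooth.

(** For i > 0, Q is a point of a line section, hence the image of a nonzero vector under a row-free
    matrix. This supplies the nonzero middle point in [omega_wordval]. *)
Lemma ec_translate_neq0 (K : fieldType) F (O T P : 'rV[K]_3) i Q :
  P != 0 -> ec_translate F O T P i Q -> Q != 0.
Proof.
move=> P0; case: i => [[k k0 ->]|i [R _ [R' [_]]]]; first by rewrite scaler_eq0 negb_or k0.
case=> L [p [q [r [k [Lfree _ [_ _ r0] [_ _ ->] _]]]]].
apply: contra r0 => /eqP rL; apply/eqP.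
by apply: (row_free_inj Lfree); rewrite rL mul0mx.
Qed.

(** * Transfer to the Sklyanin algebra *)

Section Sklyanin.
Variables (K : fieldType) (a b c : K).
Let S := sklyanin a b c.
Let X (i : nat) : S := sklyanin_gen a b c (inord i).
Let XF (i : nat) : free3 K := var K (inord i).

Definition skl_pi (f : free3 K) : S := sklyanin_pi a b c f.

Lemma skl_piD f g : skl_pi (f + g) = skl_pi f + skl_pi g.
Proof. exact: rmorphD. Qed.

Lemma skl_piZ k f : skl_pi (k *: f) = k *: skl_pi f.
Proof. exact: linearZZ. Qed.

Lemma skl_piM f g : skl_pi (f * g) = skl_pi f * skl_pi g.
Proof. exact: rmorphM. Qed.

Lemma skl_pi0 : skl_pi 0 = 0.
Proof. exact: rmorph0. Qed.

Lemma skl_pi_sum I (r : seq I) P (F : I -> free3 K) :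
  skl_pi (\sum_(i <- r | P i) F i) = \sum_(i <- r | P i) skl_pi (F i).
Proof. exact: (big_morph skl_pi skl_piD skl_pi0). Qed.

Lemma skl_pi_prod I (r : seq I) (F : I -> free3 K) :
  skl_pi (\prod_(i <- r) F i) = \prod_(i <- r) skl_pi (F i).
Proof. by apply: (big_morph skl_pi skl_piM); exact: rmorph1. Qed.

Lemma skl_pi_nceval l : skl_pi (nceval XF l) = nceval X l.
Proof.
rewrite /nceval skl_pi_sum; apply: eq_bigr => t _.
by rewrite skl_piZ skl_pi_prod.
Qed.

Lemma skl_pi_surj s : exists f, skl_pi f = s.
Proof. exact: quot_pi_surj. Qed.

Lemma skl_pi_eq0 f : skl_pi f = 0 <-> ideal_gen (sklyanin_rel a b c) f.
Proof. exact: quot_pi_ker. Qed.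

Lemma sklyanin_relP r :
  sklyanin_rel a b c r <-> exists2 i, (i < 3)%N & r = nceval XF (skl_rel a b c i).
Proof.
have i0 : inord 0 = 0 :> 'I_3 by apply: val_inj; rewrite /= inordK.
have i1 : inord 1 = 1 :> 'I_3 by apply: val_inj; rewrite /= inordK.
have i2 : inord 2 = 2%:R :> 'I_3 by apply: val_inj; rewrite /= inordK.
rewrite /sklyanin_rel -i2 -i1 -i0; split=> [/(nthP 0)[i i3 <-]|[i i3 ->]].
  by exists i; rewrite ?nceval_skl_relE.
by rewrite nceval_skl_relE // mem_nth.
Qed.

Lemma nceval_skl_rel i : nceval X (skl_rel a b c i) = 0.
Proof.
have [i3|i3] := ltnP i 3; last by rewrite /nceval /skl_rel nth_default // big_nil.
rewrite -skl_pi_nceval; apply/skl_pi_eq0.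
exists 1%N, (fun _ => 1), (fun _ => nceval XF (skl_rel a b c i)), (fun _ => 1).
split=> [_|]; first by apply/sklyanin_relP; exists i.
by rewrite big_ord1 mul1r mulr1.
Qed.

Lemma omega_central : central_elt (nceval X (omega a b c)).
Proof.
move=> s; have [f <-] := skl_pi_surj s; elim/free3_ind: f => [|f g IHf IHg|k f IHf|m].
- by rewrite skl_pi0 mulr0 mul0r.
- by rewrite skl_piD mulrDr mulrDl; congr (_ + _).
- by rewrite skl_piZ -scalerAr -scalerAl; congr (_ *: _).
rewrite mon_prod skl_pi_prod; elim: (m : seq _) => [|i w IHw].
  by rewrite big_nil mulr1 mul1r.
rewrite big_cons -(mulrA _ _ (nceval X _)) -IHw !mulrA; congr (_ * _).
rewrite -(inord_val i); apply: (omega_comm (X := X)) => // j.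
exact: nceval_skl_rel.
Qed.

Lemma omega_neq0 : a * b * c != 0 -> ~ (a ^+ 3 = c ^+ 3 /\ b ^+ 3 = c ^+ 3) ->
  nceval X (omega a b c) != 0.
Proof.
move=> abc0 cubes; apply/eqP; rewrite -skl_pi_nceval => /skl_pi_eq0 om0.
have E s t : a * b * c * ((c ^+ 3 - b ^+ 3) * s + (a ^+ 3 - b ^+ 3) * t) = 0.
  rewrite -phi_omega; transitivity (lin (A := K^o) (phi a b c s t) (nceval XF (omega a b c))).
    by rewrite (@lin_nceval K K^o).
  apply: (lin_ideal (A := K^o) _ om0) => r /sklyanin_relP[i i3 ->] u v.
  rewrite (@lin_nceval K K^o); first exact: phi_rel.
  by case: i i3 => [|[|[|]]].
(* The forms with (s, t) = (1, 0) and (0, 1) isolate c^3 - b^3 and a^3 - b^3. *)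
have /eqP := E 1 0; rewrite mulr1 mulr0 addr0 mulf_eq0 (negPf abc0) subr_eq0 => /eqP cb.
have /eqP := E 0 1; rewrite mulr1 mulr0 add0r mulf_eq0 (negPf abc0) subr_eq0 => /eqP ab.
by apply: cubes; rewrite ab cb.
Qed.

(** [lin (homog_word d)] sends f to the image in [S] of its degree d component. With
    [lin_homog_ideal] it stands in for the grading of [S]. *)
Definition homog_word d (w : seq nat) : S :=
  if size w == d then \prod_(i <- w) X i else 0.

(** The relations are homogeneous: either all words of u r v have length d, and their sum dies in
    [S], or none has, and each is sent to 0. *)
Lemma lin_homog_ideal d f :
  ideal_gen (sklyanin_rel a b c) f -> lin (homog_word d) f = 0.
Proof.
apply: lin_ideal => r /sklyanin_relP[i i3 ->] u v.
rewrite lin_nceval; last by case: i i3 => [|[|[|]]].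
have size2 t : t \in skl_rel a b c i -> size t.2 = 2%N.
  by case: i i3 => [|[|[|//]]] _; rewrite /skl_rel /= !inE => /or3P[] /eqP ->.
have [uv|uv] := eqVneq (size u + (2 + size v))%N d; last first.
  apply: big1_seq => t /andP[_ /size2 t2].
  by rewrite /homog_word !size_cat t2 (negPf uv) scaler0.
transitivity (nceval X (ncsandwich 1 u (skl_rel a b c i) v)); last first.
  by rewrite nceval_sandwich nceval_skl_rel mulr0 mul0r scaler0.
rewrite /nceval big_map; apply: eq_big_seq => t /size2 t2.
by rewrite mul1r /homog_word !size_cat t2 uv eqxx.
Qed.

(** Lift an expression of f as a sum of u g v to the free algebra and project to degree d. As g
    lifts to an element of degree d, only the constant terms of u and v survive. *)
Lemma homog_ideal d f g : lin (homog_word d) f = skl_pi f ->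
  sklyanin_homog d g -> ideal_gen (fun t => t = g) (skl_pi f) ->
  exists k, skl_pi f = k *: g.
Proof.
move=> fd [k gE] [n [u [g' [v [g'E fE]]]]].
have [U UE] := fin_all_exists (fun i => skl_pi_surj (u i)).
have [V VE] := fin_all_exists (fun i => skl_pi_surj (v i)).
pose G := \sum_(w : d.-tuple 'I_3) k w *: \prod_(j <- w) var K j.
have GE : skl_pi G = g.
  rewrite gE skl_pi_sum; apply: eq_bigr => w _.
  by rewrite skl_piZ skl_pi_prod.
have : lin (homog_word d) (f - \sum_i U i * G * V i) = 0.
  apply: lin_homog_ideal; apply/skl_pi_eq0.
  rewrite -scaleN1r skl_piD skl_piZ skl_pi_sum scaleN1r.
  rewrite fE; apply/eqP; rewrite subr_eq0; apply/eqP; apply: eq_bigr => i _.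
  by rewrite g'E !skl_piM UE VE GE.
rewrite -scaleN1r linD linZ scaleN1r => /subr0_eq; rewrite fd => ->.
rewrite lin_sum.
have term i : exists k, lin (homog_word d) (U i * G * V i) = k *: g; last first.
  have [k' k'E] := fin_all_exists term; exists (\sum_i k' i).
  by rewrite scaler_suml; apply: eq_bigr => i _; rewrite k'E.
apply: (lin_sandwich_closed (W := fun s : S => exists k, s = k *: g))
  => [|_ _ [k1 ->] [k2 ->]|k1 _ [k2 ->]|u' v'].
- by exists 0; rewrite scale0r.
- by exists (k1 + k2); rewrite scalerDl.
- by exists (k1 * k2); rewrite scalerA.
have wE (w : d.-tuple 'I_3) : \prod_(j <- [seq val i | i <- w]) X j =
    \prod_(j <- w) sklyanin_gen a b c j.
  by rewrite big_map; apply: eq_bigr => j _; rewrite /X inord_val.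
rewrite lin_sum; under eq_bigr do rewrite linZ lin_word /homog_word !size_cat size_map size_tuple.
have [/nilP u0|u0] := boolP (nilp u'); last first.
  exists 0; rewrite scale0r big1 // => w _; case: eqP; rewrite ?scaler0 // => /eqP.
  by rewrite addnCA -[X in _ == X]addn0 eqn_add2l addn_eq0 -/(nilp _) (negPf u0).
have [/nilP v0|v0] := boolP (nilp v'); last first.
  exists 0; rewrite scale0r big1 // => w _; case: eqP; rewrite ?scaler0 // => /eqP.
  by rewrite addnCA -[X in _ == X]addn0 eqn_add2l addn_eq0 -!/(nilp _) (negPf v0) andbF.
exists 1; rewrite scale1r [RHS]gE; apply: eq_bigr => w _.
by rewrite u0 v0 /= addn0 eqxx cats0 wE.
Qed.

(** * Action on point modules *)

Section Right.
Variable M : lmodType S^c.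

Lemma ractM (m : M) s t : ract m (s * t) = ract (ract m s) t.
Proof. by rewrite /ract scalerA. Qed.

Lemma ractC (m : M) k s : ract (ract m k%:A) s = ract (ract m s) k%:A.
Proof. by rewrite -!ractM mulr_algl mulr_algr. Qed.

Lemma ract_sum (m : M) I (r : seq I) (s : I -> S) :
  ract m (\sum_(i <- r) s i) = \sum_(i <- r) ract m (s i).
Proof. exact: scaler_suml. Qed.

Lemma ract_suml I (r : seq I) (m : I -> M) s :
  ract (\sum_(i <- r) m i) s = \sum_(i <- r) ract (m i) s.
Proof. exact: scaler_sumr. Qed.

Variables (m : nat -> M) (q : nat -> 'rV[K]_3).
Hypothesis mq : forall i (j : 'I_3),
  ract (m i) (sklyanin_gen a b c j) = ract (m i.+1) (q i 0 j)%:A.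

Lemma ract_word i w :
  ract (m i) (\prod_(j <- w) X j) = ract (m (i + size w)) (wordval q i w)%:A.
Proof.
elim: w i => [|j w IHw] i /=; first by rewrite big_nil addn0 scale1r.
rewrite big_cons ractM mq ractC IHw -ractM -addSnnS; congr ract.
by rewrite mulr_algl scalerA mulrC.
Qed.

Lemma ract_nceval i d l : all (fun t => size t.2 == d) l ->
  ract (m i) (nceval X l) =
  ract (m (i + d)) (\sum_(t <- l) t.1 * wordval q i t.2)%:A.
Proof.
move=> /allP ld; rewrite scaler_suml !ract_sum; apply: eq_big_seq => t /ld /eqP td.
rewrite -mulr_algr ractM ract_word td -ractM; congr ract.
by rewrite mulr_algl scalerA mulrC.
Qed.

End Right.

Lemma omega_point_ann : smooth_curve (sklyanin_cubic a b c) ->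
  point_ann (nceval X (omega a b c)).
Proof.
move=> smooth P [P0 _] M [m [q [[mspan mfree] qP mq]]] v.
have [n [k ->]] := mspan v; rewrite ract_suml big1 // => i _.
rewrite ractC (@ract_nceval _ _ _ mq _ 3) // omega_wordval ?scale0r.
- by rewrite /ract scale0r scaler0.
- exact: smooth_abc_neq0 smooth.
- exact: smooth_cubes smooth.
- exact: ec_translate_neq0 P0 (qP _).
move=> i' j j3; set s := \sum_(t <- _) _.
(* The relation [j] carries m_i' to s m_(i'+2) and is zero in [S], so freeness gives s = 0. The sum
   has i' + 3 terms to make i' + 2 its last index. *)
have /mfree : \sum_(l < i'.+3) ract (m l) ((if l == ord_max then s else 0) : K)%:A = 0.
  rewrite (bigD1 ord_max) //= eqxx big1 ?addr0 => [|l /negPf ->]; last first.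
    by rewrite scale0r /ract scale0r.
  have := nceval_skl_rel j => /(congr1 (ract (m i'))).
  rewrite (@ract_nceval _ _ _ mq _ 2) ?addn2 => [->|]; first by rewrite /ract scale0r.
  by case: j j3 {s} => [|[|[|]]].
by move/(_ ord_max); rewrite eqxx.
Qed.

Lemma homog_point_ann_central (g : S) :
  smooth_curve (sklyanin_cubic a b c) ->
  sklyanin_homog 3 g ->
  (forall s : S, point_ann s -> ideal_gen (fun t => t = g) s) ->
  central_elt g.
Proof.
move=> smooth g3 gP.
(* All words of [omega] have length 3, so the projection to degree 3 keeps it whole. *)
have om_lin :
    lin (homog_word 3) (nceval XF (omega a b c)) = skl_pi (nceval XF (omega a b c)).
  rewrite lin_nceval // skl_pi_nceval; apply: eq_big_seq => t.
  by rewrite !inE => /or4P[] /eqP ->.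
have om_gen := gP _ (omega_point_ann smooth).
rewrite -skl_pi_nceval in om_gen.
have [k om] := homog_ideal om_lin g3 om_gen.
have k0 : k != 0.
  apply: contra (omega_neq0 (smooth_abc_neq0 smooth) (smooth_cubes smooth)).
  by rewrite -skl_pi_nceval om => /eqP ->; rewrite scale0r.
have gE : g = k^-1 *: nceval X (omega a b c).
  by rewrite -skl_pi_nceval om scalerA mulVf // scale1r.
by move=> s; rewrite gE -scalerAl -scalerAr omega_central.
Qed.

End Sklyanin.

Theorem theorem4p4 (R : realType) (a b c : R[i]) (g : sklyanin a b c) :
  vec3 a b c != 0 ->
  smooth_curve (sklyanin_cubic a b c) ->
  sklyanin_homog 3 g ->
  g != 0 ->
  normal_elt g ->
  (forall s : sklyanin a b c, point_ann s <-> ideal_gen (fun t => t = g) s) ->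
  central_elt g.
Proof.
move=> _ smooth g3 _ _ gP.
by apply: homog_point_ann_central smooth g3 _ => s /gP.
Qed.
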